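(* Let $\Omega$ be a compact space with a normalized measure $\mu$, let $f$ be a continuous function on $\Omega$, and let $b>0$, $R>0$. Suppose that for every measurable $B\subset\Omega$ with $|B|\le b$, $$\|f\|_{L_\infty(\Omega)}\le R\,\|f\|_{L_\infty(\Omega\setminus B)}.$$ Then for all $0<q<p\le\infty$, $$\|f\|_p\le R^{q\beta}\,b^{-\beta}\,\|f\|_q,\qquad \beta:=\frac1q-\frac1p .$$
   Context: $\mu$ is a Borel measure on $\Omega$ with $\mu(\Omega)=1$, and $|B|=\mu(B)$. For $0<p<\infty$ and measurable $E\subset\Omega$, $\|f\|_{L_p(E)}=\big(\int_E|f|^p\,d\mu\big)^{1/p}$; $\|f\|_{L_\infty(E)}$ is the essential supremum of $|f|$ over $E$ (with respect to $\mu$); $\|f\|_p=\|f\|_{L_p(\Omega)}$. Convention: $1/\infty=0$. *)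

(* Defs.v *)
From HB Require Import structures.
From mathcomp Require Import all_boot all_order all_algebra complex.
From mathcomp Require Import all_classical all_reals all_analysis.

Set Implicit Arguments.
Unset Strict Implicit.
Unset Printing Implicit Defensive.

Import Order.TTheory GRing.Theory Num.Theory.
Import numFieldNormedType.Exports.

Local Open Scope classical_set_scope.
Local Open Scope ring_scope.

Definition borelType (T : ptopologicalType) := g_sigma_algebraType (@open T).

(* The norm of K[i] takes its (real) values in K[i]; [normc] is the same
   modulus with values in K, see [normc_def]. *)
Definition emodulus (K : realType) (T : Type) (f : T -> K[i]) (x : T) : \bar K :=
  (ComplexField.Normc.normc (f x))%:E.

(* ||f||_{L_p(E)}: the norm of f with respect to the restriction of mu to E. For
   p = +oo it is the essential supremum over E, and 0 when mu E = 0. *)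
Definition LpNormOn (K : realType) (T : ptopologicalType)
    (mu : {measure set (borelType T) -> \bar K}) (p : \bar K)
    (E : set (borelType T)) (mE : measurable E) (f : T -> K[i]) : \bar K :=
  'N[mrestr mu mE]_p[emodulus f].

Definition LpNorm (K : realType) (T : ptopologicalType)
    (mu : {measure set (borelType T) -> \bar K}) (p : \bar K)
    (f : T -> K[i]) : \bar K :=
  'N[mu]_p[emodulus f].

(* Main.v *)
Require Import Defs.
From HB Require Import structures.
From mathcomp Require Import all_boot all_order all_algebra complex.
From mathcomp Require Import all_classical all_reals all_analysis.
From mathcomp Require Import measurable_realfun ess_sup_inf hoelder.

(**
  Put [t = b^(-1/q) ||f||_q] and [B = {|f| > t}]. Chebyshev's inequality gives
  [mu B <= b], and [|f| <= t] off [B], so the hypothesis yields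
  [||f||_oo <= R t]. This is the case [p = oo]; for finite [p], insert it in
  [||f||_p <= ||f||_oo^(1 - q/p) ||f||_q^(q/p)].
*)

Import Order.TTheory GRing.Theory Num.Theory.
Import numFieldNormedType.Exports.

Local Open Scope classical_set_scope.
Local Open Scope ring_scope.

(** The rays []r, +oo[] generate the Borel sets of [K], and their preimages under the modulus are
    open: by the triangle inequality, moving [f x] by less than [|f x| - r] keeps the modulus above
    [r]. *)
Lemma measurable_emodulus (K : realType) (T : ptopologicalType)
    (f : T -> K[i]) (cf : continuous (f : T -> (K[i])^o)) :
  measurable_fun [set: borelType T] (emodulus f : borelType T -> \bar K).
Proof.
apply/measurable_EFinP => _.
apply: (measurability _ (RGenOInfty.measurableE K)) => //.
move=> /= _ [_ [r ->] <-]; rewrite setTI; apply: sub_sigma_algebra => /=.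
rewrite openE => x /=; rewrite in_itv/= andbT => rfx.
have e0 : 0 < ((ComplexField.Normc.normc (f x) - r)%:C)%C :> K[i].
  by rewrite ltcR subr_gt0.
move/cvgrPdist_lt: (cf x) => /(_ _ e0).
apply: filterS => y; rewrite /= in_itv/= andbT.
rewrite [`|_|](_ : _ = (ComplexField.Normc.normc (f x - f y))%:C%C)// ltcR => fxy.
have := le_normcD (f x - f y) (f y); rewrite subrK => h.
by rewrite ltNge; apply/negP => fyr; move: fxy; rewrite ltNge lerBlDr (le_trans h)// lerD2l.
Qed.

Local Open Scope ereal_scope.

Section Lnorm_interpolation.
Context d (T : measurableType d) (K : realType).
Variables (mu : {measure set T -> \bar K}) (f : T -> \bar K).
Hypothesis mf : measurable_fun [set: T] f.

Lemma abse_le_Lnormy : \forall x \ae mu, `|f x| <= 'N[mu]_+oo[f].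
Proof.
rewrite unlock; case: ifPn => [_|]; first exact: (ess_sup_ge mu (abse \o f)).
(* On a space of measure zero the sup norm is 0 by convention, but there the whole space is an
   admissible exceptional set. *)
rewrite -leNgt => mu0; exists setT; split => //.
by apply/eqP; rewrite eq_le mu0/=.
Qed.

Let measurable_absf : measurable_fun [set: T] (abse \o f).
Proof. exact: (measurableT_comp (@abse_measurable _ _)). Qed.

Let measurable_superlevel (t : K) : measurable [set x | t%:E < `|f x|].
Proof.
rewrite (_ : [set _ | _] = [set: T] `&` (abse \o f) @^-1` `]t%:E, +oo[%classic).
  by apply: measurable_absf => //; exact: emeasurable_itv.
by rewrite setTI; apply/seteqP; split => x /=; rewrite in_itv/= andbT.
Qed.

Let measurable_powf (r : K) : measurable_fun [set: T] (fun x => `|f x| `^ r).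
Proof. exact: (measurableT_comp (measurable_poweR r)). Qed.

(* Integrate |f|^p = |f|^(p - q) |f|^q <= ||f||_oo^(p - q) |f|^q. *)
Lemma Lnorm_interpolation (p q : K) : (0 < q)%R -> (q < p)%R ->
  'N[mu]_p%:E[f] <= 'N[mu]_+oo[f] `^ (1 - q / p) * 'N[mu]_q%:E[f] `^ (q / p).
Proof.
move=> q0 qp; have p0 : (0 < p)%R by exact: lt_trans qp.
have ipq : \int[mu]_x `|f x| `^ p <=
    'N[mu]_+oo[f] `^ (p - q) * \int[mu]_x `|f x| `^ q.
  rewrite -ge0_integralZl//; last 2 first.
  - by move=> x _; exact: poweR_ge0.
  - exact: poweR_ge0.
  apply: ae_ge0_le_integral => //.
  - by move=> x _; exact: poweR_ge0.
  - by move=> x _; rewrite mule_ge0// poweR_ge0.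
  - exact: emeasurable_funM.
  apply: filterS abse_le_Lnormy => x fx _.
  (* The exponents add up to [p], which is nonzero, so the law of exponents also covers the values 0
     and [+oo] of [|f x|]. *)
  have -> : `|f x| `^ p = `|f x| `^ (p - q) * `|f x| `^ q.
    rewrite -poweRD ?subrK//.
    by apply: add_neq0_poweRD_def; rewrite subrK gt_eqF.
  rewrite lee_wpmul2r ?poweR_ge0// gt0_ler_poweR ?subr_ge0 ?(ltW qp)//.
  - by rewrite in_itv/= abse_ge0 leey.
  - by rewrite in_itv/= Lnorm_ge0 leey.
have -> : 'N[mu]_p%:E[f] = (\int[mu]_x `|f x| `^ p) `^ p^-1 by rewrite unlock.
have -> : (1 - q / p = (p - q) * p^-1)%R by rewrite mulrBl divff ?gt_eqF.
rewrite !poweRrM powR_Lnorm ?gt_eqF// -poweRM; last 2 first.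
- exact: poweR_ge0.
- by apply: integral_ge0 => x _; exact: poweR_ge0.
rewrite gt0_ler_poweR ?invr_ge0 ?(ltW p0)//.
- by rewrite in_itv/= leey andbT; apply: integral_ge0 => x _; exact: poweR_ge0.
- rewrite in_itv/= leey andbT mule_ge0 ?poweR_ge0//.
  by apply: integral_ge0 => x _; exact: poweR_ge0.
Qed.

(** Chebyshev on the larger closed set [t <= |f|] gives [t^q mu {t <= |f|} <= ||f||_q^q <= b t^q];
    then [t^q] is cancelled. *)
Lemma mu_superlevel_le (b q t : K) : (0 < b)%R -> (0 < q)%R ->
  'N[mu]_q%:E[f] <= (b `^ q^-1 * t)%:E -> mu [set x | t%:E < `|f x|] <= b%:E.
Proof.
move=> b0 q0 Nt.
have bq0 : (0 < b `^ q^-1)%R by rewrite powR_gt0.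
have t0 : (0 <= t)%R.
  rewrite -(pmulr_rge0 _ bq0) -lee_fin.
  exact: (le_trans (Lnorm_ge0 _ _ _) Nt).
have mF : measurable [set x | t%:E <= `|f x|].
  rewrite (_ : [set _ | _] = [set: T] `&` (abse \o f) @^-1` `[t%:E, +oo[%classic).
    by apply: measurable_absf => //; exact: emeasurable_itv.
  by rewrite setTI; apply/seteqP; split => x /=; rewrite in_itv/= andbT.
(* For t = 0 Chebyshev is void, but then f vanishes almost everywhere. *)
move: t0; rewrite le_eqVlt => /predU1P[t0|t0].
  subst t.
  have N0 : 'N[mu]_q%:E[f] = 0.
    by apply/eqP; rewrite eq_le Lnorm_ge0 andbT (le_trans Nt)// mulr0.
  have /negligibleP : mu.-negligible [set x | 0%:E < `|f x|].
    have := @Lnorm_eq0_eq0 _ _ _ mu f q%:E mf q0 N0.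
    apply: negligibleS => x /= fx H.
    by move: fx; rewrite (H I) abse0 ltxx.
  by move=> ->//; rewrite lee_fin ltW.
have tq0 : (0 < t `^ q)%R by rewrite powR_gt0.
have : (t `^ q)%:E * mu [set x | t%:E <= `|f x|] <= 'N[mu]_q%:E[f] `^ q.
  rewrite powR_Lnorm ?gt_eqF// -poweR_EFin -[X in mu X]setTI.
  apply: (le_integral_comp_abse mu measurableT (measurable_poweR q)) => //.
  - by move=> r _; exact: poweR_ge0.
  - move=> x y; rewrite !inE/= !in_itv/= !andbT => x0 y0 xy.
    by rewrite gt0_ler_poweR ?(ltW q0)// in_itv/= ?x0 ?y0 leey.
move=> markov_t; rewrite -(@lee_pmul2l _ (t `^ q)%:E)//.
apply: (le_trans (y := (t `^ q)%:E * mu [set x | t%:E <= `|f x|])).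
  rewrite lee_pmul2l// le_measure ?inE// => x /=; exact: ltW.
apply: (le_trans markov_t).
apply: (le_trans (y := (b `^ q^-1 * t)%:E `^ q)).
  rewrite gt0_ler_poweR ?(ltW q0)// in_itv/= leey andbT ?Lnorm_ge0//.
  by rewrite (le_trans (Lnorm_ge0 _ _ _) Nt).
by rewrite poweR_EFin lee_fin powRM ?(ltW bq0) ?(ltW t0)// -powRrM mulVf ?gt_eqF//
  powRr1 ?(ltW b0)// mulrC.
Qed.

(** This is the endpoint [p = +oo] of the theorem, where [beta = q^-1] and [q * beta = 1]. *)
Lemma Lnormy_le_Lnorm (b R q : K) : (0 < b)%R -> (0 < R)%R -> (0 < q)%R ->
  (forall (B : set T) (mB : measurable B), mu B <= b%:E ->
    'N[mu]_+oo[f] <= R%:E * 'N[mrestr mu (measurableC mB)]_+oo[f]) ->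
  'N[mu]_+oo[f] <= (R * b `^ (- q^-1))%:E * 'N[mu]_q%:E[f].
Proof.
move=> b0 R0 q0 hf.
have bq0 : (0 < b `^ (- q^-1))%R by rewrite powR_gt0.
(* If the [q]-norm is infinite, so is the right-hand side, its constant being positive; otherwise
   the level [t] is a real number. *)
have := Lnorm_ge0 mu q%:E f; case Nq : ('N[mu]_q%:E[f]) => [N| |]// N0; last first.
  by rewrite gt0_muley ?leey// lte_fin mulr_gt0.
pose t := (b `^ (- q^-1) * N)%R.
have t0 : (0 <= t)%R by rewrite mulr_ge0 ?(ltW bq0).
pose B := [set x | t%:E < `|f x|].
have mB : measurable B by exact: measurable_superlevel.
have muB : mu B <= b%:E.
  apply: (mu_superlevel_le b q) => //.
  by rewrite Nq /t powRN mulVKf// gt_eqF// powR_gt0.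
apply: (le_trans (hf B mB muB)).
rewrite -EFinM -mulrA EFinM lee_pmul2l//.
(* If the complement of [B] is null, the norm over it is 0, at most [t]. Otherwise [B] itself is the
   exceptional set: it contains every point with [|f| > t] and is null for the measure restricted to
   its complement. *)
rewrite unlock; case: ifPn => [_|//]; apply/ess_supP.
exists B; split => //; first exact: (etrans (congr1 mu (setICr B))).
by move=> x /=; rewrite /B/= => /negP; rewrite -ltNge.
Qed.

End Lnorm_interpolation.

Local Close Scope ereal_scope.

Theorem proposition2p1 (K : realType) (Omega : ptopologicalType)
    (compactOmega : compact [set: Omega])
    (mu : probability (borelType Omega) K)
    (f : Omega -> K[i]) (cf : continuous (f : Omega -> (K[i])^o))
    (b R : K) (b_gt0 : 0 < b) (R_gt0 : 0 < R)
    (hf : forall (B : set (borelType Omega)) (mB : measurable B),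
       (mu B <= b%:E)%E ->
       (LpNorm mu +oo f <= R%:E * LpNormOn mu +oo (measurableC mB) f)%E)
    (q : K) (p : \bar K) (q_gt0 : 0 < q) (q_lt_p : (q%:E < p)%E) :
  let beta : K := q^-1 - fine (p^-1)%E in
  (LpNorm mu p f <= (R `^ (q * beta) * b `^ (- beta))%:E * LpNorm mu q%:E f)%E.
Proof.
rewrite /=.
have mf := measurable_emodulus _ _ _ cf.
have Ny := Lnormy_le_Lnorm _ _ _ mu _ mf _ _ _ b_gt0 R_gt0 q_gt0 hf.
rewrite /LpNorm; case: p q_lt_p => [p| |//] qp; last first.
  by rewrite invey/= subr0 mulfV ?gt_eqF// powRr1 ?(ltW R_gt0).
rewrite lte_fin in qp; set beta := q^-1 - _.
have p0 : 0 < p by exact: lt_trans qp.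
have betaE : beta = q^-1 - p^-1 by rewrite /beta inver gt_eqF.
have qbE : q * beta = 1 - q / p by rewrite betaE mulrBr mulfV ?gt_eqF.
have qb0 : 0 <= q * beta by rewrite qbE subr_ge0 ler_pdivrMr// mul1r ltW.
apply: (le_trans (Lnorm_interpolation _ _ _ mu _ mf _ _ q_gt0 qp)).
rewrite -qbE.
set N := ('N[mu]_q%:E[_])%E in Ny *.
have N0 : (0 <= N)%E by exact: Lnorm_ge0.
(* The sup norm carries the exponent [1 - q / p = q * beta], which is nonnegative, so its bound [Ny]
   may be raised to that power. *)
apply: (le_trans (y := ((R * b `^ (- q^-1))%:E * N) `^ (q * beta) * N `^ (q / p))%E).
  rewrite lee_wpmul2r ?poweR_ge0// gt0_ler_poweR// in_itv/= leey andbT.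
    exact: Lnorm_ge0.
  by rewrite mule_ge0// lee_fin mulr_ge0 ?powR_ge0// ltW.
rewrite poweRM//; last by rewrite lee_fin mulr_ge0 ?powR_ge0// ltW.
(* The two powers of [N] merge into [N] itself, since [q * beta + q / p = 1]; this total being
   nonzero, [N] may be 0 or [+oo]. *)
rewrite -muleA -poweRD; last first.
  by apply: add_neq0_poweRD_def; rewrite qbE subrK oner_eq0.
rewrite qbE subrK poweRe1// -qbE poweR_EFin powRM ?powR_ge0 ?(ltW R_gt0)//.
by rewrite -powRrM mulNr mulrA mulVf ?gt_eqF// mul1r.
Qed.
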